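(* Let $(\mathcal{H},W)$ be a hypernetwork with cells $C$ and hyperedges $E$, and let $\mathcal{D}_{\mathcal{H}}$ be its weighted incidence digraph. Then: (i) For each balanced equivalence relation $\bowtie$ for $(\mathcal{H},W)$, the corresponding equivalence relation $\bowtie_{\mathcal{D}}$ on $C\cup E$ is balanced for $\mathcal{D}_{\mathcal{H}}$. (ii) Each balanced equivalence relation $\tilde{\bowtie}$ on $C\cup E$ for $\mathcal{D}_{\mathcal{H}}$ projects to a balanced equivalence relation $\tilde{\bowtie}_{\mathcal{H}}$ on $C$ for $(\mathcal{H},W)$.
   Context: Directed hypergraphs. A directed hypergraph $\mathcal{H}=(C,E)$ consists of a finite set $C=\{1,\dots,n\}$ of nodes (cells) and a finite set $E=\{e_1,\dots,e_m\}$ of directed hyperedges; a directed hyperedge is a pair $e=(T(e),H(e))$ where the tail $T(e)$ is a nonempty multiset of elements of $C$ and the head $H(e)$ is a nonempty subset of $C$; $\#T(e)$ is counted with multiplicity. Each $e$ has a real weight $w_e$; the weight matrix $W$ has $(i,j)$ entry $w_{e_j}$ if $i\in H(e_j)$ and $0$ otherwise. A hypernetwork is a weighted directed hypergraph $(\mathcal{H},W)$ all of whose nodes carry the same phase space and internal dynamics. All hypergraphs have nonempty node and hyperedge sets and are weakly connected. Let $BS(c)=\{e\in E:c\in H(e)\}$, $BS_k(c)=\{e\in BS(c):\#T(e)=k\}$, $B(c)=\{k:BS_k(c)\neq\emptyset\}$, $B(\mathcal{H})=\bigcup_cB(c)$. Input equivalence $\sim_I$ on $C$: cells with empty $BS$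 are equivalent; cells $c,c'$ with nonempty $BS$ are equivalent iff $B(c)=B(c')$ and $\sum_{e\in BS_k(c)}w_e=\sum_{e\in BS_k(c')}w_e$ for all $k\in B(c)$. Balanced relations for $(\mathcal{H},W)$. Let $\bowtie$ be an equivalence relation on $C$ with ordered classes $(\overline{c}_1,\dots,\overline{c}_p)$. The pattern determined by $\bowtie$ on $e$ is $\overrightarrow{m}(e)=(m_1,\dots,m_p)$, $m_i$ being the number of elements of $T(e)$ (with multiplicity) in $\overline{c}_i$. For $e\in BS_k(c)$, the weight of $\overrightarrow{m}(e)$ on $c$ is the sum of the weights of all $e'\in BS_k(c)$ with $\overrightarrow{m}(e')=\overrightarrow{m}(e)$. The relation $\bowtie$ is balanced if it refines $\sim_I$ and, for every $k\in B(\mathcal{H})$ and any two distinct cells $c\bowtie c'$, the set of patterns of hyperedges in $BS_k(c)$ coincides with the set of patterns of hyperedges in $BS_k(c')$ and each such pattern has the same weight on both cells. Incidence digraph. $\mathcal{D}_{\mathcal{H}}$ is the weighted bipartite digraph with node set $C\cup E$: there is a directed edge from node $i\in C$ to $e_j\in E$, with weight equal to the multiplicity of $i$ in $T(e_j)$, iff $i\in T(e_j)$; and there is a directed edge from $e_j$ to $i$, with weight $w_{e_j}$, iff $i\in H(e_j)$. Balanced relations for a weighted digraph. An equivalence relation on the nodes of a weighted digraph is balanced if for any two equivalent nodes $c,c'$ and every equivalence class $K$: $c$ receives an edge from a node of $K$ iff $c'$ does, and the sum of the weights of the edges from nodes of $K$ to $c$ equals the sum of the weights of the edges from nodes of $K$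 to $c'$. Correspondence of relations. Given $\bowtie$ on $C$, the relation $\bowtie_{\mathcal{D}}$ on $C\cup E$ is defined by: $c\bowtie_{\mathcal{D}}c'$ iff $c\bowtie c'$ for $c,c'\in C$; $e_i\bowtie_{\mathcal{D}}e_j$ iff $\overrightarrow{m}(e_i)=\overrightarrow{m}(e_j)$ for $e_i,e_j\in E$ (patterns with respect to $\bowtie$); no element of $C$ is related to an element of $E$. Given $\tilde{\bowtie}$ on $C\cup E$, its projection $\tilde{\bowtie}_{\mathcal{H}}$ on $C$ is defined by $c\,\tilde{\bowtie}_{\mathcal{H}}\,c'$ iff $c\,\tilde{\bowtie}\,c'$, for $c,c'\in C$. *)

(* Defs.v *)
From mathcomp Require Import all_boot all_order all_algebra.
From mathcomp Require Import finmap multiset.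
From mathcomp Require Import reals.

Set Implicit Arguments.
Unset Strict Implicit.
Unset Printing Implicit Defensive.

Import GRing.Theory Num.Theory.
Local Open Scope mset_scope.
Local Open Scope ring_scope.

(* Weighted digraphs on V with at most one edge from u to v.  The edge relation
   is separate from the weights because an edge may have weight 0; [dweight u v]
   is irrelevant when there is no edge from u to v. *)
Record wdigraph (R : realType) (V : finType) := WDigraph {
  dedge : rel V;
  dweight : V -> V -> R
}.

Definition classes_of (V : finType) (r : rel V) : {set {set V}} :=
  equivalence_partition r [set: V].

Definition dbalanced (R : realType) (V : finType) (D : wdigraph R V)
    (r : rel V) : Prop :=
  equivalence_rel r /\
  forall c c' : V, r c c' -> forall K : {set V}, K \in classes_of r ->
    [exists u in K, dedge D u c] = [exists u in K, dedge D u c'] /\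
    \sum_(u in K | dedge D u c) dweight D u c =
    \sum_(u in K | dedge D u c') dweight D u c'.

(* Two cells are adjacent when they belong to a common hyperedge, tails and
   heads not being distinguished. *)
Definition hadjacent (n m : nat) (T : 'I_m -> {mset 'I_n})
    (H : 'I_m -> {set 'I_n}) : rel 'I_n :=
  fun c c' => [exists e, ((c \in T e) || (c \in H e)) &&
                         ((c' \in T e) || (c' \in H e))].

(* Cells are 'I_n and hyperedges are e_j with j : 'I_m.  As the hyperedges form
   a set of pairs (tail, head), distinct indices give distinct pairs. *)
Record dhypergraph (n m : nat) := DHypergraph {
  htail : 'I_m -> {mset 'I_n};
  hhead : 'I_m -> {set 'I_n};
  cells_gt0 : (0 < n)%N;
  hyperedges_gt0 : (0 < m)%N;
  htail_neq0 : forall e, htail e != mset0;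
  hhead_neq0 : forall e, hhead e != set0;
  hyperedge_inj : injective (fun e => (htail e, hhead e));
  weakly_connected : forall c c', connect (hadjacent htail hhead) c c'
}.

Record hypernetwork (R : realType) (n m : nat) := Hypernetwork {
  hgraph :> dhypergraph n m;
  hweight : 'I_m -> R
}.

(* Heads being nonempty, this matrix and the weights determine each other. *)
Definition weight_mx (R : realType) (n m : nat) (N : hypernetwork R n m) :
    'M[R]_(n, m) :=
  \matrix_(i, j) (if i \in hhead N j then hweight N j else 0).

Section Hypernetwork.
Variables (R : realType) (n m : nat) (N : hypernetwork R n m).

Definition BS (c : 'I_n) : {set 'I_m} := [set e | c \in hhead N e].

(* The size of a multiset counts multiplicities. *)
Definition BSk (k : nat) (c : 'I_n) : {set 'I_m} :=
  [set e in BS c | size (htail N e) == k].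

Definition Bc (c : 'I_n) : pred nat := [pred k | BSk k c != set0].

Definition BH : pred nat := [pred k | [exists c, k \in Bc c]].

Definition input_equiv (c c' : 'I_n) : Prop :=
  (BS c = set0 /\ BS c' = set0) \/
  [/\ BS c != set0, BS c' != set0, Bc c =i Bc c' &
      forall k, k \in Bc c ->
        \sum_(e in BSk k c) hweight N e = \sum_(e in BSk k c') hweight N e].

(* The enumeration of the finite set of classes fixes their order. *)
Definition pattern (bw : rel 'I_n) (e : 'I_m) : seq nat :=
  [seq (\sum_(i in K) htail N e i)%N | K : {set 'I_n} <- enum (classes_of bw)].

Definition patterns (bw : rel 'I_n) (k : nat) (c : 'I_n) : seq (seq nat) :=
  [seq pattern bw e | e in BSk k c].

Definition pattern_weight (bw : rel 'I_n) (k : nat) (c : 'I_n) (p : seq nat) : R :=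
  \sum_(e in BSk k c | pattern bw e == p) hweight N e.

Definition hbalanced (bw : rel 'I_n) : Prop :=
  [/\ equivalence_rel bw,
      forall c c', bw c c' -> input_equiv c c' &
      forall k, k \in BH -> forall c c', c != c' -> bw c c' ->
        patterns bw k c =i patterns bw k c' /\
        forall p, p \in patterns bw k c ->
          pattern_weight bw k c p = pattern_weight bw k c' p].

Definition incidence_edge : rel ('I_n + 'I_m)%type :=
  fun x y => match x, y with
  | inl i, inr e => i \in htail N e
  | inr e, inl i => i \in hhead N e
  | _, _ => false
  end.

Definition incidence_weight (x y : 'I_n + 'I_m) : R :=
  match x, y with
  | inl i, inr e => (htail N e i)%:R
  | inr e, inl i => hweight N e
  | _, _ => 0
  end.

Definition incidence_digraph : wdigraph R ('I_n + 'I_m)%type :=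
  WDigraph incidence_edge incidence_weight.

Definition rel_incidence (bw : rel 'I_n) : rel ('I_n + 'I_m)%type :=
  fun x y => match x, y with
  | inl c, inl c' => bw c c'
  | inr e, inr e' => pattern bw e == pattern bw e'
  | _, _ => false
  end.

End Hypernetwork.

Definition rel_proj (n m : nat) (r : rel ('I_n + 'I_m)%type) : rel 'I_n :=
  fun c c' => r (inl c) (inl c').

(* Main.v *)
Require Import Defs.
From mathcomp Require Import all_boot all_order all_algebra.
From mathcomp Require Import finmap multiset.
From mathcomp Require Import reals.

(** In the incidence digraph, the total weight of the edges into a hyperedge
    [e] from a class of cells is the corresponding entry of the pattern of
    [e], and the total weight of the edges into a cell [c] from a class of
    hyperedges is a sum of hyperedge weights over part of [BS c].

    For (i), a class of hyperedges of [rel_incidence N bw] consists of all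
    hyperedges with a given pattern [p].  The entries of [p] add up to the
    size of the tail, so this class only meets one layer [BSk k c]; it reaches
    [c] iff [p] is a pattern on [c], and then with total weight the weight of
    [p] on [c].  Hence [bw] being balanced is what is needed at the cells
    ([incidence_class_patterns], [incidence_class_weight]), and there is
    nothing to check at the hyperedges, related ones having equal patterns.

    For (ii), let [r] be balanced on cells and hyperedges; it may relate cells
    to hyperedges, which does no harm since edges into a cell only come from
    hyperedges and edges into a hyperedge only from cells.  Balance at
    hyperedges says that [r]-related hyperedges have the same pattern for the
    projection, hence the same tail size ([dbalanced_pattern]).  Balance at
    cells, summed over the classes, says that [r]-related cells have equal
    total weights over the hyperedges satisfying any [r]-invariant property
    ([dbalanced_sum], [dbalanced_exists]).  The two invariant properties used
    are to have a tail of size [k], which gives input equivalence, and to have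
    moreover a given pattern, which gives balance. *)

Set Implicit Arguments.
Unset Strict Implicit.
Unset Printing Implicit Defensive.

Import GRing.Theory Num.Theory.
Local Open Scope ring_scope.

(** * Classes of an equivalence relation *)

Section Classes.
Variables (V : finType) (r : rel V).

Lemma classes_ofP (K : {set V}) :
  reflect (exists x, K = [set y | r x y]) (K \in classes_of r).
Proof.
have cls x : [set y in [set: V] | r x y] = [set y | r x y].
  by apply/setP => y; rewrite !inE.
by apply: (iffP imsetP) => [[x _ ->]|[x ->]]; exists x; rewrite ?cls ?inE.
Qed.

Lemma class_in_classes_of (x : V) : [set y | r x y] \in classes_of r.
Proof. by apply/classes_ofP; exists x. Qed.

Hypothesis r_equiv : equivalence_rel r.

Lemma equiv_refl (x : V) : r x x.
Proof. by have [] := r_equiv x x x. Qed.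

Lemma equiv_left_trans (x y z : V) : r x y -> r x z = r y z.
Proof. by have [] := r_equiv x y z. Qed.

Lemma equiv_sym (x y : V) : r x y -> r y x.
Proof. by move=> rxy; rewrite -(equiv_left_trans _ rxy) equiv_refl. Qed.

Lemma classes_of_partition : partition (classes_of r) [set: V].
Proof. by apply: equivalence_partitionP => x y z _ _ _; apply: r_equiv. Qed.

Lemma class_related (K : {set V}) (x y : V) :
  K \in classes_of r -> x \in K -> y \in K -> r x y.
Proof.
move=> /classes_ofP[z ->]; rewrite !inE => rzx rzy.
by rewrite -(equiv_left_trans _ rzx).
Qed.

End Classes.

(** * Patterns of hyperedges *)

Section Patterns.
Variables (R : realType) (n m : nat) (N : hypernetwork R n m).
Variable bw : rel 'I_n.

(** This holds for any relation: the classes are the sets of cells [i] with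
    [bw c i], for [c] a cell, so the enumeration of classes plays no role. *)
Lemma pattern_eqP (e e' : 'I_m) :
  pattern N bw e = pattern N bw e' <->
  forall c, (\sum_(i | bw c i) htail N e i = \sum_(i | bw c i) htail N e' i)%N.
Proof.
have cls f c : (\sum_(i in [set j | bw c j]) htail N f i =
    \sum_(i | bw c i) htail N f i)%N by apply: eq_bigl => i; rewrite inE.
split=> [/eq_in_map eqp c|eqs].
  by rewrite -!cls; apply: eqp; rewrite mem_enum class_in_classes_of.
apply/eq_in_map => K; rewrite mem_enum => /classes_ofP[c ->].
by rewrite !cls.
Qed.

Lemma sumn_pattern (e : 'I_m) :
  equivalence_rel bw -> sumn (pattern N bw e) = size (htail N e).
Proof.
move=> bw_equiv; rewrite sumnE big_map big_enum /=.
rewrite -(set_partition_big _ (classes_of_partition bw_equiv)) size_mset.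
rewrite big_uniq ?fset_uniq //= [RHS]big_mkcond /=.
apply: eq_big => [i|i _]; first by rewrite inE.
by case: ifPn => // /fsfun_dflt.
Qed.

Lemma patternsP (k : nat) (c : 'I_n) (p : seq nat) :
  reflect (exists e, [/\ c \in hhead N e, size (htail N e) = k
                       & pattern N bw e = p])
          (p \in patterns N bw k c).
Proof.
apply: (iffP imageP) => [[e]|[e [ce <- <-]]].
  by rewrite !inE => /andP[ce /eqP sz] ->; exists e.
by exists e; rewrite // !inE ce eqxx.
Qed.

End Patterns.

(** * Edges of the incidence digraph into a node *)

Section Incidence.
Variables (R : realType) (n m : nat) (N : hypernetwork R n m).
Local Notation D := (incidence_digraph N).
Implicit Types (K : {set 'I_n + 'I_m}) (c : 'I_n) (e : 'I_m).

Lemma in_weight_hyperedge K e :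
  \sum_(u in K | dedge D u (inr e)) dweight D u (inr e) =
  (\sum_(i | inl i \in K) htail N e i)%N%:R.
Proof.
rewrite big_sumType /= [X in _ + X]big_pred0 ?addr0; last first.
  by move=> f; rewrite andbF.
rewrite natr_sum big_mkcondr /=; apply: eq_bigr => i _.
by rewrite in_mset; case: posnP => // ->.
Qed.

Lemma in_edge_hyperedge K e :
  [exists u in K, dedge D u (inr e)] =
  (0 < \sum_(i | inl i \in K) htail N e i)%N.
Proof.
rewrite lt0n sum_nat_eq0 negb_forall_in.
apply/exists_inP/exists_inP => [[[i|f] //= Ki ei]|[i Ki ei]].
  by exists i; rewrite // -lt0n mset_gt0.
by exists (inl i); rewrite //= -mset_gt0 lt0n.
Qed.

Lemma in_weight_cell K c :
  \sum_(u in K | dedge D u (inl c)) dweight D u (inl c) =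
  \sum_(e | (inr e \in K) && (c \in hhead N e)) hweight N e.
Proof.
rewrite big_sumType /= [X in X + _]big_pred0 ?add0r //.
by move=> f; rewrite andbF.
Qed.

Lemma in_edge_cellP K c :
  reflect (exists e, inr e \in K /\ c \in hhead N e)
          [exists u in K, dedge D u (inl c)].
Proof.
apply: (iffP exists_inP) => [[[i|e] //= Ke ce]|[e [Ke ce]]].
  by exists e.
by exists (inr e).
Qed.

(** * From balanced relations of the hypernetwork to the digraph *)

Section FromHypernetwork.
Variable bw : rel 'I_n.
Hypothesis bw_equiv : equivalence_rel bw.

Lemma rel_incidence_equiv : equivalence_rel (rel_incidence N bw).
Proof.
move=> x y z; split.
  by case: z => [c|e] /=; rewrite ?(equiv_refl bw_equiv).
case: x y => [x|x] [y|y] //=; case: z => [z|z] //=.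
  exact: (equiv_left_trans bw_equiv).
by move/eqP->.
Qed.

(** The size of the tail is determined by the pattern, so restricting to the
    layer [BSk k] with [k := size (htail N e)] loses no hyperedge with the
    pattern of [e]. *)
Lemma incidence_class_patterns c e :
  [exists u in [set y | rel_incidence N bw (inr e) y], dedge D u (inl c)] =
  (pattern N bw e \in patterns N bw (size (htail N e)) c).
Proof.
apply/in_edge_cellP/patternsP => [[f []]|[f [cf _ pf]]].
  rewrite inE /= => /eqP pf cf; exists f; split=> //.
  by rewrite -!(sumn_pattern N _ bw_equiv) pf.
by exists f; rewrite inE /= pf eqxx.
Qed.

Lemma incidence_class_weight c e :
  \sum_(u in [set y | rel_incidence N bw (inr e) y] | dedge D u (inl c))
     dweight D u (inl c) =
  pattern_weight N bw (size (htail N e)) c (pattern N bw e).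
Proof.
rewrite in_weight_cell; apply: eq_bigl => f; rewrite !inE /=.
rewrite [RHS]andbC [in RHS]eq_sym; case: eqP => //= pf.
by rewrite -!(sumn_pattern N _ bw_equiv) pf eqxx andbT.
Qed.

End FromHypernetwork.

Lemma hbalanced_incidence (bw : rel 'I_n) :
  hbalanced N bw -> dbalanced D (rel_incidence N bw).
Proof.
case=> bw_equiv _ bal; split; first exact: rel_incidence_equiv.
move=> [c|e] [c'|e'] //= rel K /classes_ofP[x ->].
  case: (eqVneq c c') => [-> //|neq_cc'].
  (* [K] is the class of a cell or of a hyperedge. *)
  case: x => [x|e].
    (* A class of cells sends no edge to a cell. *)
    have noedge d : [exists u in [set y | rel_incidence N bw (inl x) y],
                       dedge D u (inl d)] = false.
      by apply/in_edge_cellP => -[e []]; rewrite inE.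
    by rewrite !noedge !in_weight_cell !big_pred0 // => e; rewrite inE.
  rewrite !incidence_class_patterns // !incidence_class_weight //.
  set k := size _; set p := pattern _ _ _.
  case kBH: (k \in BH N).
    have [eqp eqw] := bal k kBH c c' neq_cc' rel.
    rewrite -eqp; split=> //.
    case pc: (p \in patterns N bw k c); first exact: eqw.
    have nopat d : (p \in patterns N bw k d) = false ->
        pattern_weight N bw k d p = 0.
      move=> /patternsP nop; apply: big_pred0 => f; rewrite !inE.
      apply/negP => /andP[/andP[df /eqP sz] /eqP pf].
      by apply: nop; exists f.
    by rewrite !nopat // -eqp.
  (* [k] is the tail size of [e], whose head is nonempty, so [k \in BH N]. *)
  have [d de] := set0Pn _ (hhead_neq0 N e).
  case/negP: (negbT kBH); apply/existsP; exists d.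
  by rewrite inE; apply/set0Pn; exists e; rewrite !inE de eqxx.
rewrite !in_edge_hyperedge !in_weight_hyperedge.
suff -> : (\sum_(i | inl i \in [set y | rel_incidence N bw x y])
    htail N e i = \sum_(i | inl i \in [set y | rel_incidence N bw x y])
    htail N e' i)%N by [].
case: x => [c|f]; last by rewrite !big_pred0 // => i; rewrite inE.
have cls i : (inl i \in [set y | rel_incidence N bw (inl c) y]) = bw c i.
  by rewrite inE.
rewrite !(eq_bigl _ _ cls).
by move/eqP: rel => /pattern_eqP.
Qed.

(** * From balanced relations of the digraph to the hypernetwork *)

Section FromDigraph.
Variable r : rel ('I_n + 'I_m)%type.
Hypothesis r_bal : dbalanced D r.

Lemma dbalanced_pattern e e' :
  r (inr e) (inr e') ->
  pattern N (rel_proj r) e = pattern N (rel_proj r) e'.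
Proof.
move=> ree'; apply/pattern_eqP => c.
have [_] := r_bal.2 _ _ ree' _ (class_in_classes_of r (inl c)).
rewrite !in_weight_hyperedge => /eqP; rewrite eqr_nat => /eqP.
have cls i : (inl i \in [set y | r (inl c) y]) = rel_proj r c i by rewrite inE.
by rewrite !(eq_bigl _ _ cls).
Qed.

Section InvariantSums.
Variable Q : pred 'I_m.
Hypothesis Q_inv : forall e e', r (inr e) (inr e') -> Q e = Q e'.

Lemma dbalanced_exists c c' :
  r (inl c) (inl c') -> (exists2 e, c \in hhead N e & Q e) ->
  exists2 e, c' \in hhead N e & Q e.
Proof.
move=> rcc' [e ce Qe].
have [eqe _] := r_bal.2 _ _ rcc' _ (class_in_classes_of r (inr e)).
have : [exists u in [set y | r (inr e) y], dedge D u (inl c')].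
  rewrite -eqe; apply/in_edge_cellP; exists e.
  by rewrite inE (equiv_refl r_bal.1).
move=> /in_edge_cellP[f []]; rewrite inE => ref cf.
by exists f; rewrite // -(Q_inv ref).
Qed.

Lemma dbalanced_sum c c' :
  r (inl c) (inl c') ->
  \sum_(e | (c \in hhead N e) && Q e) hweight N e =
  \sum_(e | (c' \in hhead N e) && Q e) hweight N e.
Proof.
move=> rcc'; pose Qn (u : 'I_n + 'I_m) := if u is inr e then Q e else false.
have byclass d : \sum_(e | (d \in hhead N e) && Q e) hweight N e =
    \sum_(K in classes_of r) \sum_(u in K | dedge D u (inl d) && Qn u)
      dweight D u (inl d).
  rewrite -(set_partition_big_cond _ (classes_of_partition r_bal.1)).
  rewrite big_sumType /= [X in X + _]big_pred0 ?add0r.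
    by apply: eq_bigl => e; rewrite inE.
  by move=> f; rewrite andbF.
rewrite !byclass; apply: eq_bigr => K Kr.
(* On a given class, Q holds for all hyperedges or for none. *)
case: (pickP [pred e | (inr e \in K) && Q e]) => [e /andP[Ke Qe]|noQ].
  have QK d u : (u \in K) && (dedge D u (inl d) && Qn u) =
      (u \in K) && dedge D u (inl d).
    case: u => [i|f] //=; case Kf: (inr f \in K) => //=.
    by rewrite -(Q_inv (class_related r_bal.1 Kr Ke Kf)) Qe andbT.
  by rewrite !(eq_bigl _ _ (QK _)); have [_] := r_bal.2 _ _ rcc' _ Kr.
have Q0 d u : (u \in K) && (dedge D u (inl d) && Qn u) = false.
  case: u => [i|f] /=; first by rewrite andbF.
  by rewrite andbCA; have /= -> := noQ f; rewrite andbF.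
by rewrite !(eq_bigl _ _ (Q0 _)) !big_pred0_eq.
Qed.

End InvariantSums.

Lemma rel_proj_equiv : equivalence_rel (rel_proj r).
Proof. by move=> x y z; apply: r_bal.1. Qed.

Lemma dbalanced_size e e' :
  r (inr e) (inr e') -> size (htail N e) = size (htail N e').
Proof.
move=> ree'; rewrite -!(sumn_pattern N _ rel_proj_equiv).
by rewrite (dbalanced_pattern ree').
Qed.

(** The next three lemmas give one inclusion or implication each; exchanging
    the two cells gives the other. *)
Lemma BS_transfer c c' :
  r (inl c) (inl c') -> BS N c != set0 -> BS N c' != set0.
Proof.
move=> rcc' /set0Pn[e]; rewrite inE => ce.
have [//||f c'f _] := @dbalanced_exists predT _ c c' rcc'; first by exists e.
by apply/set0Pn; exists f; rewrite inE.
Qed.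

Lemma Bc_transfer c c' k :
  r (inl c) (inl c') -> k \in Bc N c -> k \in Bc N c'.
Proof.
move=> rcc'; rewrite !inE => /set0Pn[e]; rewrite !inE => /andP[ce sz].
have [||f c'f szf] :=
    @dbalanced_exists (fun e => size (htail N e) == k) _ c c' rcc'.
- by move=> f f' /dbalanced_size ->.
- by exists e.
by apply/set0Pn; exists f; rewrite !inE c'f.
Qed.

Lemma patterns_transfer c c' k p :
  r (inl c) (inl c') -> p \in patterns N (rel_proj r) k c ->
  p \in patterns N (rel_proj r) k c'.
Proof.
move=> rcc' /patternsP[e [ce sz pe]].
pose Q f := (size (htail N f) == k) && (pattern N (rel_proj r) f == p).
have [||f c'f /andP[/eqP szf /eqP pf]] := @dbalanced_exists Q _ c c' rcc'.
- move=> f f' rff'.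
  by rewrite /Q (dbalanced_size rff') (dbalanced_pattern rff').
- by exists e; rewrite // /Q sz pe !eqxx.
by apply/patternsP; exists f.
Qed.

Lemma dbalanced_proj : hbalanced N (rel_proj r).
Proof.
have sym c c' : r (inl c) (inl c') -> r (inl c') (inl c).
  exact: equiv_sym r_bal.1 _ _.
split; first exact: rel_proj_equiv.
- move=> c c' rcc'; have rc'c := sym _ _ rcc'.
  have [BSc|BSc] := eqVneq (BS N c) set0.
    left; split=> //; apply/eqP; apply: contraT => /(BS_transfer rc'c).
    by rewrite BSc eqxx.
  right; split=> //; first exact: BS_transfer BSc.
    by move=> k; apply/idP/idP; apply: Bc_transfer.
  move=> k _.
  have szsum d : \sum_(e in BSk N k d) hweight N e =
      \sum_(e | (d \in hhead N e) && (size (htail N e) == k)) hweight N e.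
    by apply: eq_bigl => e; rewrite !inE.
  by rewrite !szsum; apply: dbalanced_sum rcc' => f f' /dbalanced_size ->.
move=> k _ c c' _ rcc'; have rc'c := sym _ _ rcc'; split.
  by move=> p; apply/idP/idP; apply: patterns_transfer.
move=> p _; rewrite /pattern_weight.
pose Q f := (size (htail N f) == k) && (pattern N (rel_proj r) f == p).
have psum d : \sum_(e in BSk N k d | pattern N (rel_proj r) e == p)
      hweight N e = \sum_(e | (d \in hhead N e) && Q e) hweight N e.
  by apply: eq_bigl => e; rewrite !inE -andbA.
rewrite !psum; apply: dbalanced_sum rcc' => f f' rff'.
by rewrite /Q (dbalanced_size rff') (dbalanced_pattern rff').
Qed.

End FromDigraph.

End Incidence.

Theorem theorem4p21 (R : realType) (n m : nat) (N : hypernetwork R n m) :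
  (forall bw : rel 'I_n,
     hbalanced N bw -> dbalanced (incidence_digraph N) (rel_incidence N bw)) /\
  (forall r : rel ('I_n + 'I_m)%type,
     dbalanced (incidence_digraph N) r -> hbalanced N (rel_proj r)).
Proof.
split=> [bw|r]; first exact: hbalanced_incidence.
exact: dbalanced_proj.
Qed.
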